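(* Let $\alpha=(G,X,\{X_g\}_{g\in G},\{\alpha_g\}_{g\in G})$ be a partial action of a group $G$ on a set $X$, and let $(\mathcal{R},K)$ be a partial action congruence on $\alpha$. Let $\overline{G}=G/K$, $\overline{X}=X/\mathcal{R}$, and write $\overline{g}$, $\overline{x}$ for classes. For $\overline g\in\overline G$ define $$D_{\overline g}:=\{\overline{\operatorname{t}(\mathfrak c)}\in\overline X:\ \mathfrak c \text{ is an } \mathcal R\text{-chain of }\alpha \text{ with } \overline{\epsilon(\mathfrak c)}=\overline g\}$$ and define $\theta_{\overline g}:D_{\overline g^{-1}}\to D_{\overline g}$ by $\theta_{\overline g}(\overline{\operatorname{s}(\mathfrak c)})=\overline{\operatorname{t}(\mathfrak c)}$ for every $\mathcal R$-chain $\mathfrak c$ with $\overline{\epsilon(\mathfrak c)}=\overline g$. Then $\theta:=(\overline G,\overline X,\{D_{\overline g}\},\{\theta_{\overline g}\})$ is a (well-defined) partial action of $\overline G$ on $\overline X$, and the canonical maps $\pi_0:X\to\overline X$ and $\pi_1:G\to\overline G$ determine a morphism of partial actions $\pi:=(\pi_0,\pi_1):\alpha\to\theta$.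
   Context: Partial action: $\alpha=(G,X,\{X_g\},\{\alpha_g\})$ of a group $G$ on a set $X$ consists of subsets $X_g\subseteq X$ and bijections $\alpha_g:X_{g^{-1}}\to X_g$ ($g\in G$) such that (i) $X_1=X$, $\alpha_1=1_X$; (ii) $\alpha_g(X_{g^{-1}}\cap X_{g^{-1}h})\subseteq X_g\cap X_h$; (iii) $\alpha_g\alpha_h(x)=\alpha_{gh}(x)$ for $x\in X_{h^{-1}}\cap X_{h^{-1}g^{-1}}$. Morphism of partial actions $(G,X,\{X_g\},\{\alpha_g\})\to(S,Y,\{Y_s\},\{\beta_s\})$: a pair $(\phi_0,\phi_1)$ with $\phi_0:X\to Y$ a map and $\phi_1:G\to S$ a group homomorphism such that $\phi_0(X_g)\subseteq Y_{\phi_1(g)}$ and $\phi_0(\alpha_g(x))=\beta_{\phi_1(g)}(\phi_0(x))$ for $x\in X_{g^{-1}}$. $\mathcal R$-chain: for an equivalence relation $\mathcal R$ on $X$, an $\mathcal R$-chain (of length $n\ge1$) is a tuple $\mathfrak c=(x_1\delta_{g_1},\dots,x_n\delta_{g_n})$ ($\delta_g$ are placeholders, i.e. a tuple of pairs $(x_i,g_i)\in X\times G$) with $x_i\in X_{g_i}$ for all $i$ and $\alpha_{g_{i-1}^{-1}}(x_{i-1})\sim_{\mathcal R}x_i$ for $1<i\le n$. Put $\operatorname{t}(\mathfrak c)=x_1$, $\operatorname{s}(\mathfrak c)=\alpha_{g_n^{-1}}(x_n)$, $\epsilon(\mathfrak c)=g_1g_2\cdots g_n$. Partial action congruence on $\alpha$: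 a pair $(\mathcal R,K)$, $\mathcal R$ an equivalence relation on $X$, $K$ a normal subgroup of $G$, such that for all $\mathcal R$-chains $\mathfrak c,\mathfrak o$ with $\epsilon(\mathfrak c)K=\epsilon(\mathfrak o)K$: $\operatorname{s}(\mathfrak c)\sim_{\mathcal R}\operatorname{s}(\mathfrak o)\Leftrightarrow\operatorname{t}(\mathfrak c)\sim_{\mathcal R}\operatorname{t}(\mathfrak o)$. *)

(* Defs.v *)
From HB Require Import structures.
From mathcomp Require Import all_boot generic_quotient monoid.
From mathcomp Require Import boolp classical_sets functions.

Set Implicit Arguments.
Unset Strict Implicit.
Unset Printing Implicit Defensive.

Local Open Scope classical_set_scope.
Local Open Scope group_scope.
Local Open Scope quotient_scope.

Record equivalence (X : Type) := Equivalence {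
  eqv :> X -> X -> Prop;
  eqv_refl : forall x, eqv x x;
  eqv_sym : forall x y, eqv x y -> eqv y x;
  eqv_trans : forall x y z, eqv x y -> eqv y z -> eqv x z }.

Record normal_subgroup (G : groupType) := NormalSubgroup {
  nsg :> G -> Prop;
  nsg1 : nsg 1;
  nsgM : forall x y, nsg x -> nsg y -> nsg (x * y);
  nsgV : forall x, nsg x -> nsg x^-1;
  nsgJ : forall x g, nsg x -> nsg (g^-1 * x * g) }.

Section Quotients.
Variables (X : choiceType) (R : equivalence X).

Definition eqv_bool : rel X := fun x y => `[< R x y >].

Lemma eqv_bool_refl : reflexive eqv_bool.
Proof. by move=> x; apply/asboolP; exact: eqv_refl. Qed.

Lemma eqv_bool_sym : symmetric eqv_bool.
Proof. by move=> x y; apply/asboolP/asboolP; exact: eqv_sym. Qed.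

Lemma eqv_bool_trans : transitive eqv_bool.
Proof.
by move=> y x z /asboolP xy /asboolP yz; apply/asboolP; exact: eqv_trans xy yz.
Qed.

Canonical eqv_equiv := EquivRel eqv_bool eqv_bool_refl eqv_bool_sym eqv_bool_trans.

Definition quot := {eq_quot eqv_equiv}.
HB.instance Definition _ := Choice.on quot.
HB.instance Definition _ := Quotient.on quot.

Lemma quotP (x y : X) : \pi_quot x = \pi_quot y <-> R x y.
Proof.
have := @eqmodP _ eqv_equiv x y; rewrite /= /eqv_bool => eP.
by split=> [/eP/asboolP|/asboolP/eP].
Qed.

End Quotients.

Section QuotientGroup.
Variables (G : groupType) (K : normal_subgroup G).

(* x K = y K *)
Definition cosetrel (x y : G) : Prop := K (x^-1 * y).

Lemma cosetrel_refl x : cosetrel x x.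
Proof. by rewrite /cosetrel mulVg; exact: nsg1. Qed.

Lemma cosetrel_sym x y : cosetrel x y -> cosetrel y x.
Proof. by rewrite /cosetrel => /nsgV; rewrite invgM invgK. Qed.

Lemma cosetrel_trans x y z : cosetrel x y -> cosetrel y z -> cosetrel x z.
Proof.
by rewrite /cosetrel => xy yz; have := nsgM xy yz; rewrite mulgA mulgK.
Qed.

Definition coset_eqv := Equivalence cosetrel_refl cosetrel_sym cosetrel_trans.

Definition quotg := quot coset_eqv.
HB.instance Definition _ := Choice.on quotg.
HB.instance Definition _ := Quotient.on quotg.

Lemma quotgP (x y : G) : \pi_quotg x = \pi_quotg y <-> K (x^-1 * y).
Proof. exact: (quotP coset_eqv). Qed.

Definition quotg_one : quotg := \pi_quotg 1.
Definition quotg_mul (a b : quotg) : quotg := \pi_quotg (repr a * repr b).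
Definition quotg_inv (a : quotg) : quotg := \pi_quotg (repr a)^-1.

Lemma repr_quotg (x : G) : K (x^-1 * repr (\pi_quotg x)).
Proof. by apply/quotgP; rewrite reprK. Qed.

Lemma quotg_mulE (x y : G) :
  quotg_mul (\pi_quotg x) (\pi_quotg y) = \pi_quotg (x * y).
Proof.
apply/esym/quotgP; set x' := repr _; set y' := repr _.
have -> : (x * y)^-1 * (x' * y') = (y^-1 * (x^-1 * x') * y) * (y^-1 * y').
  by rewrite invgM !mulgA mulgK.
by apply: nsgM; [apply: nsgJ|]; exact: repr_quotg.
Qed.

Lemma quotg_invE (x : G) : quotg_inv (\pi_quotg x) = \pi_quotg x^-1.
Proof.
apply/quotgP; rewrite invgK; set x' := repr _.
have -> : x' * x^-1 = x^-1^-1 * (x^-1 * x') * x^-1 by rewrite invgK mulVKg.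
by apply: nsgJ; exact: repr_quotg.
Qed.

Lemma quotg_mulA : associative quotg_mul.
Proof.
elim/quotW=> x; elim/quotW=> y; elim/quotW=> z.
rewrite (quotg_mulE x y) (quotg_mulE y z).
by rewrite (quotg_mulE x) (quotg_mulE _ z) mulgA.
Qed.

Lemma quotg_mul1g : left_id quotg_one quotg_mul.
Proof. by elim/quotW=> x; rewrite quotg_mulE mul1g. Qed.

Lemma quotg_mulg1 : right_id quotg_one quotg_mul.
Proof. by elim/quotW=> x; rewrite quotg_mulE mulg1. Qed.

Lemma quotg_mulVg : left_inverse quotg_one quotg_inv quotg_mul.
Proof. by elim/quotW=> x; rewrite (quotg_invE x) quotg_mulE mulVg. Qed.

Lemma quotg_mulgV : right_inverse quotg_one quotg_inv quotg_mul.
Proof. by elim/quotW=> x; rewrite (quotg_invE x) quotg_mulE mulgV. Qed.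

HB.instance Definition _ := isGroup.Build quotg
  quotg_mulA quotg_mul1g quotg_mulg1 quotg_mulVg quotg_mulgV.

End QuotientGroup.

(* The partial bijection alpha_g : X_{g^-1} -> X_g is encoded by a total map    *)
(* pact g, whose values outside pdom g^-1 are irrelevant.                       *)
Record partial_data (G : groupType) (X : Type) := PartialData {
  pdom : G -> set X;
  pact : G -> X -> X }.

Record is_partial_action (G : groupType) (X : Type) (a : partial_data G X) :
    Prop := IsPartialAction {
  pact_bij : forall g, set_bij (pdom a g^-1) (pdom a g) (pact a g);
  pdom1 : pdom a 1 = setT;
  pact1 : forall x, pact a 1 x = x;
  pactI : forall g h,
    pact a g @` (pdom a g^-1 `&` pdom a (g^-1 * h)) `<=` pdom a g `&` pdom a h;
  pactM : forall g h x, (pdom a h^-1 `&` pdom a (h^-1 * g^-1)) x ->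
    pact a g (pact a h x) = pact a (g * h) x }.

Record is_pmorphism (G S : groupType) (X Y : Type)
    (a : partial_data G X) (b : partial_data S Y)
    (phi0 : X -> Y) (phi1 : G -> S) : Prop := IsPMorphism {
  pmorM : forall g h, phi1 (g * h) = phi1 g * phi1 h;
  pmor_dom : forall g, phi0 @` pdom a g `<=` pdom b (phi1 g);
  pmor_act : forall g x, pdom a g^-1 x ->
    phi0 (pact a g x) = pact b (phi1 g) (phi0 x) }.

Section Chains.
Variables (G : groupType) (X : choiceType).
Variables (a : partial_data G X) (R : equivalence X).

(* A chain is a nonempty sequence of pairs (x_i, g_i) standing for              *)
(* x_i delta_{g_i}; chead is the pair of index 1.                               *)
Record chain := Chain {
  chead : X * G;
  ctail : seq (X * G);
  chain_dom : all (fun p => `[< pdom a p.2 p.1 >]) (chead :: ctail);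
  chain_path :
    path (fun p q => `[< R (pact a p.2^-1 p.1) q.1 >]) chead ctail }.

Definition tgt (c : chain) : X := (chead c).1.

Definition src (c : chain) : X :=
  let p := last (chead c) (ctail c) in pact a p.2^-1 p.1.

Definition eps (c : chain) : G := \prod_(p <- chead c :: ctail c) p.2.

End Chains.

Definition is_congruence (G : groupType) (X : choiceType)
    (a : partial_data G X) (R : equivalence X) (K : normal_subgroup G) : Prop :=
  forall c o : chain a R, \pi_(quotg K) (eps c) = \pi_(quotg K) (eps o) ->
    (R (src c) (src o) <-> R (tgt c) (tgt o)).

Section QuotientAction.
Variables (G : groupType) (X : choiceType) (a : partial_data G X).
Variables (R : equivalence X) (K : normal_subgroup G).

Definition qdom (g : quotg K) : set (quot R) :=
  [set \pi_(quot R) (tgt c) | c in [set c : chain a R | \pi_(quotg K) (eps c) = g]].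

(* Some class of tgt c, for a chain c over g with src c in the class x, and x   *)
(* itself when there is no such chain.                                          *)
Definition qact (g : quotg K) (x : quot R) : quot R :=
  xget x [set \pi_(quot R) (tgt c) | c in
    [set c : chain a R |
      \pi_(quotg K) (eps c) = g /\ \pi_(quot R) (src c) = x]].

Definition qdata : partial_data (quotg K) (quot R) := PartialData qdom qact.

End QuotientAction.

(* Main.v *)
Require Import Defs.
From HB Require Import structures.
From mathcomp Require Import all_boot generic_quotient monoid.
From mathcomp Require Import boolp classical_sets functions.

Local Open Scope classical_set_scope.
Local Open Scope group_scope.
Local Open Scope quotient_scope.

(** A chain [c] links the class of its target to the class of its source over
    the coset of [eps c]. Concatenating chains, reversing them, and taking the
    chain [(x, 1)] show that links compose, invert and contain the identity;
    the congruence condition says that each end of a link over a given coset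
    determines the other. These four properties are those of the graph of a
    partial action of the quotient group. *)

Definition linked {G : groupType} {X : choiceType} (a : partial_data G X)
    (R : equivalence X) (x : X) (g : G) (y : X) : Prop :=
  exists c : chain a R, [/\ tgt c = x, eps c = g & src c = y].

(** For fixed [g] this is the graph of theta_g, with [v] as argument and [u] as value. *)
Definition qlinked {G : groupType} {X : choiceType} (a : partial_data G X)
    {R : equivalence X} {K : normal_subgroup G}
    (u : quot R) (g : quotg K) (v : quot R) : Prop :=
  exists c : chain a R, [/\ \pi_(quot R) (tgt c) = u,
    \pi_(quotg K) (eps c) = g & \pi_(quot R) (src c) = v].

Section Linked.
Context {G : groupType} {X : choiceType} (a : partial_data G X).
Context (R : equivalence X).

Lemma linked1 {g : G} {x : X} :
  pdom a g x -> linked a R x g (pact a g^-1 x).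
Proof.
move=> gx; have dx : all (fun p => `[< pdom a p.2 p.1 >]) [:: (x, g)].
  by rewrite /= andbT; apply/asboolP.
by exists (@Chain _ _ a R (x, g) [::] dx isT); rewrite /eps /= big_seq1.
Qed.

(** Concatenation of chains: [R y z] is exactly the chain condition at the junction. *)
Lemma linked_cat (x y z w : X) (g h : G) :
  linked a R x g y -> R y z -> linked a R z h w -> linked a R x (g * h) w.
Proof.
move=> [[p s ds ps] [/= <- <- <-]] yz [[q t dt pt] [/= zE <- <-]].
have d : all (fun p => `[< pdom a p.2 p.1 >]) (p :: (s ++ q :: t)).
  by rewrite -cat_cons all_cat ds dt.
have e : path (fun p q => `[< R (pact a p.2^-1 p.1) q.1 >]) p (s ++ q :: t).
  rewrite cat_path /= ps pt andbT /=; apply/asboolP.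
  by move: yz; rewrite -zE.
exists (Chain d e); split=> //; first by rewrite /eps /= -cat_cons big_cat.
by rewrite /src /= last_cat.
Qed.

(** Induction on the length of a chain, removing its first pair. *)
Lemma linked_ind (P : X -> G -> X -> Prop) :
  (forall g x, pdom a g x -> P x g (pact a g^-1 x)) ->
  (forall g h x y z, pdom a g x -> R (pact a g^-1 x) y -> linked a R y h z ->
     P y h z -> P x (g * h) z) ->
  forall x g y, linked a R x g y -> P x g y.
Proof.
move=> P1 PM x g y [[p s ds ps] [<- <- <-]]; rewrite /tgt /eps /src /=.
elim: s p ds ps => [|q s IHs] [x1 g1] ds ps.
  by rewrite big_seq1; apply: P1; move: ds; rewrite /= andbT => /asboolP.
have /andP[/asboolP d1 dt] := ds; have /andP[/asboolP e1 et] := ps.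
rewrite big_cons; apply: PM d1 e1 _ (IHs _ dt et).
by exists (Chain dt et).
Qed.

Hypothesis aP : is_partial_action a.

Lemma pdom_pactV {g : G} {x : X} : pdom a g x -> pdom a g^-1 (pact a g^-1 x).
Proof.
by have [+ _ _] := pact_bij aP g^-1; rewrite invgK => + gx; apply.
Qed.

(** This is [pactM] for [g] and [g^-1], where the second domain condition becomes membership in
    [pdom a 1]. *)
Lemma pactKV (g : G) (x : X) : pdom a g x -> pact a g (pact a g^-1 x) = x.
Proof.
move=> gx; rewrite (pactM aP) ?mulgV ?(pact1 aP) //.
by rewrite invgK mulgV (pdom1 aP).
Qed.

(** The reversed chain lists the pairs [(pact a g_i^-1 x_i, g_i^-1)] in the opposite order; its
    junctions hold by symmetry of [R]. *)
Lemma linkedV (x y : X) (g : G) :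
  linked a R x g y -> linked a R y g^-1 x.
Proof.
have linkedV1 h z : pdom a h z -> linked a R (pact a h^-1 z) h^-1 z.
  by move=> hz; have := linked1 (pdom_pactV hz); rewrite invgK pactKV.
move: x g y; apply: linked_ind => // g h x y z gx xy _ yhz.
by rewrite invgM; apply: linked_cat yhz (eqv_sym xy) (linkedV1 _ _ gx).
Qed.

Context (K : normal_subgroup G).
Implicit Types (u v w : quot R) (g h : quotg K).

Lemma linked_qlinked (x y : X) (g : G) : linked a R x g y ->
  qlinked a (\pi_(quot R) x) (\pi_(quotg K) g) (\pi_(quot R) y).
Proof. by move=> [c [<- <- <-]]; exists c. Qed.

Lemma qlinkedM {u v w g h} :
  qlinked a u g v -> qlinked a v h w -> qlinked a u (g * h) w.
Proof.
move=> [c [<- <- <-]] [o [/esym/Defs.quotP co <- <-]].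
have -> : \pi_(quotg K) (eps c) * \pi_(quotg K) (eps o)
  = \pi_(quotg K) (eps c * eps o) by exact: quotg_mulE.
by apply: linked_qlinked; apply: linked_cat co _; [exists c|exists o].
Qed.

Lemma qlinkedV {u v g} : qlinked a u g v -> qlinked a v g^-1 u.
Proof.
move=> [c [<- <- <-]].
have -> : (\pi_(quotg K) (eps c))^-1 = \pi_(quotg K) (eps c)^-1.
  exact: quotg_invE.
by apply: linked_qlinked; apply: linkedV; exists c.
Qed.

Lemma qlinked1 u : qlinked a u (1 : quotg K) u.
Proof.
elim/quotW: u => x; have := @linked1 1 x; rewrite (pdom1 aP) => /(_ I).
by rewrite invg1 (pact1 aP) => /linked_qlinked.
Qed.

Lemma qdomP g u : qdom a g u <-> exists v, qlinked a u g v.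
Proof.
split=> [[c cg <-]|[v [c [<- cg _]]]]; last by exists c.
by exists (\pi_(quot R) (src c)), c.
Qed.

Lemma qdomVP g v : qdom a g^-1 v <-> exists u, qlinked a u g v.
Proof.
split=> [/qdomP[u /qlinkedV]|[u /qlinkedV guv]]; last by apply/qdomP; exists u.
by rewrite invgK; exists u.
Qed.

Hypothesis RKP : is_congruence a R K.

(** The congruence condition read on classes: left to right it makes theta_g single-valued, right to
    left injective. *)
Lemma qlinked_tgt_src {u v u' v' g} :
  qlinked a u g v -> qlinked a u' g v' -> v = v' <-> u = u'.
Proof.
move=> [c [<- cg <-]] [o [<- og <-]].
have /RKP[st ts] : \pi_(quotg K) (eps c) = \pi_(quotg K) (eps o) by rewrite og.
by split=> /Defs.quotP ?; apply/Defs.quotP; [exact: st|exact: ts].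
Qed.

(** Whatever class [xget] picks is linked to [v] over [g], hence equals [u]; the default value
    cannot occur, as the given link is a candidate. *)
Lemma qactE {u v g} : qlinked a u g v -> qact a g v = u.
Proof.
move=> guv; rewrite /qact; case: xgetP => [w _ [c [cg cv] cw]|noc].
  have gwv : qlinked a w g v by exists c.
  exact/(qlinked_tgt_src gwv guv).
by case: guv noc => c [cu cg cv] /(_ u)[]; exists c.
Qed.

Lemma qdata_partial_action : is_partial_action (qdata a R K).
Proof.
split=> /=.
- move=> g; split.
  + move=> v /qdomVP[u guv]; rewrite (qactE guv).
    by apply/qdomP; exists v.
  + move=> v v'; rewrite !in_setE => /qdomVP[u guv] /qdomVP[u' guv'].
    rewrite (qactE guv) (qactE guv').
    exact: (qlinked_tgt_src guv guv').2.
  + move=> u /qdomP[v guv]; exists v; last exact: qactE.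
    by apply/qdomVP; exists u.
- by apply/seteqP; split=> // u _; apply/qdomP; exists u; exact: qlinked1.
- by move=> u; apply: qactE; exact: qlinked1.
(* The value [u] is linked to [v] over [g], and [v] to [w] over [g^-1 * h]; composing puts [u] in
   the domain at [h]. *)
- move=> g h _ [v [/qdomVP[u guv] /qdomP[w ghvw]] <-].
  rewrite (qactE guv); split; apply/qdomP; first by exists v.
  by exists w; have := qlinkedM guv ghvw; rewrite mulVKg.
(* Composing the link from [w] to [v] over [g * h] with the reversed link from [v] to [u] over
   [h^-1] links [w] to [u] over [g]. *)
- move=> g h v [/qdomVP[u huv]]; rewrite -invgM => /qdomVP[w ghwv].
  rewrite (qactE huv) (qactE ghwv); apply: qactE.
  by have := qlinkedM ghwv (qlinkedV huv); rewrite mulgK.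
Qed.

Lemma pi_pmorphism :
  is_pmorphism a (qdata a R K) \pi_(quot R) \pi_(quotg K).
Proof.
split=> /= [g h|g _ [x gx <-]|g x gx]; first exact/esym/quotg_mulE.
  apply/qdomP; exists (\pi_(quot R) (pact a g^-1 x)).
  by apply: linked_qlinked; exact: linked1.
(* The one-term chain [(x, g^-1)] has target [x] and source [pact a g x]; its reversal is the
   required link over [g]. *)
apply/esym/qactE/linked_qlinked; rewrite -[g]invgK.
by apply: linkedV; exact: linked1.
Qed.

End Linked.

Theorem theorem1p12 (G : groupType) (X : choiceType) (alpha : partial_data G X)
    (R : equivalence X) (K : normal_subgroup G)
    (alphaP : is_partial_action alpha) (RKP : is_congruence alpha R K) :
  let theta := qdata alpha R K in
  [/\ (* each theta_g is well defined on D_{g^-1} by theta_g (s c) = t c *)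
      forall g : quotg K,
        pdom theta g^-1 = [set \pi_(quot R) (src c) | c in
          [set c : chain alpha R | \pi_(quotg K) (eps c) = g]],
      forall (g : quotg K) (c : chain alpha R), \pi_(quotg K) (eps c) = g ->
        pact theta g (\pi_(quot R) (src c)) = \pi_(quot R) (tgt c),
      is_partial_action theta
    & is_pmorphism alpha theta \pi_(quot R) \pi_(quotg K)].
Proof.
move=> theta; split=> /= [g|g c cg||].
- apply/seteqP; split=> v.
    by move=> /(qdomVP _ _ alphaP)[_ [c [_ cg cv]]]; exists c.
  move=> [c cg cv]; apply/(qdomVP _ _ alphaP).
  by exists (\pi_(quot R) (tgt c)), c.
- by apply: qactE => //; exists c.
- exact: qdata_partial_action.
- exact: pi_pmorphism.
Qed.
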